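(* Let $(X,\tau)$ be a non-trivial real Hausdorff locally convex space with topological dual $X^*$. The following are equivalent: (i) For every $f\in\Gamma_\tau(X)$, $\partial f$ is maximal monotone. (ii) For every $f\in\Gamma_\tau(X)$, $x\in\operatorname{dom}f$, $f(x)=\inf_{\epsilon>0}f_\epsilon^{\smile}(x)$. (iii)' For every $f\in\Gamma_\tau(X)$, $\epsilon>0$, $x\in\operatorname{dom}f$, $f(x)=f_\epsilon^{\smile}(x)$. (iv)' For every $f\in\Gamma_\tau(X)$, $\epsilon>0$, $f=f_\epsilon^{\smile}$.
   Context: $\langle x,x^*\rangle:=x^*(x)$. Conventions: $\overline{\mathbb R}=[-\infty,\infty]$, $\infty-\infty=\infty$, $\sup\emptyset=-\infty$, $\inf\emptyset=\infty$. For $f:X\to\overline{\mathbb R}$: $\operatorname{dom}f=\{x\in X\mid f(x)<\infty\}$; $f$ is proper if $\operatorname{dom}f\ne\emptyset$ and $f$ never takes the value $-\infty$. $\Gamma_\tau(X)$ is the class of proper convex $\tau$-lower semicontinuous functions $f:X\to\overline{\mathbb R}$. The subdifferential $\partial f:X\rightrightarrows X^*$: $x^*\in\partial f(x)$ iff $f(x)$ is finite and $f(y)\ge f(x)+\langle y-x,x^*\rangle$ for every $y\in X$. For $T:X\rightrightarrows X^*$, $\operatorname{Graph}T=\{(x,x^* )\mid x^*\in T(x)\}$. $T$ is monotone if $\langle x_1-x_2,x_1^*-x_2^*\rangle\ge0$ for all $(x_1,x_1^* ),(x_2,x_2^* )\in\operatorname{Graph}T$; it is maximal monotone if it is nonempty,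 monotone and maximal (with respect to graph inclusion in $X\times X^*$) among monotone operators. For $\epsilon>0$ and $x\in X$, $f_\epsilon^{\smile}(x):=\sup\{\langle x-a,a^*\rangle+f(a)\mid(a,a^* )\in\operatorname{Graph}(\partial f),\ f(a)\le f(x)+\epsilon\}$. *)

(* Defs.v *)
From HB Require Import structures.
From mathcomp Require Export all_boot all_order all_algebra.
From mathcomp Require Export all_classical all_reals all_analysis.
Import Order.TTheory GRing.Theory Num.Theory.
Import numFieldNormedType.Exports.

Set Implicit Arguments.
Unset Strict Implicit.
Unset Printing Implicit Defensive.

Local Open Scope classical_set_scope.
Local Open Scope ring_scope.

(* A [tvsType R] is a locally convex space: its topology makes addition and
   scaling continuous and has a basis of convex sets.  It also carries a
   uniformity inducing this topology, which is never used below. *)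
Record dual (R : realType) (X : tvsType R) := Dual {
  dual_fun :> {scalar X} ;
  dual_continuous : continuous (dual_fun : X -> R)
}.

Section ConvexAnalysis.
Context {R : realType} {X : tvsType R}.
Implicit Types (f : X -> \bar R) (T S : X -> set (dual X)).

Definition edom f : set X := [set x | (f x < +oo)%E].

Definition proper_fun f : Prop := edom f !=set0 /\ forall x, f x <> -oo%E.

(* The right-hand side is computed in [\bar^d R], where +oo - oo = +oo. *)
Definition convex_efun f : Prop :=
  forall (x y : X) (t : R), 0 < t -> t < 1 ->
    (f (t *: x + (1 - t) *: y)%R <= (t%:E * f x + (1 - t)%:E * f y)%dE)%E.

Definition Gamma : set (X -> \bar R) :=
  [set f | [/\ proper_fun f, convex_efun f & lower_semicontinuous f]].

Definition subdiff f : X -> set (dual X) :=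
  fun x => [set x' : dual X | f x \is a fin_num /\
                    forall y, (f x + (x' (y - x)%R)%:E <= f y)%E].

Definition Graph T : set (X * dual X) := [set p | T p.1 p.2].

Definition monotone_op T : Prop :=
  forall p q, Graph T p -> Graph T q -> 0 <= p.2 (p.1 - q.1) - q.2 (p.1 - q.1).

Definition maximal_monotone T : Prop :=
  [/\ Graph T !=set0, monotone_op T &
      forall S, monotone_op S -> Graph T `<=` Graph S -> Graph S = Graph T].

Definition smile (eps : R) f : X -> \bar R := fun x =>
  ereal_sup [set ((p.2 (x - p.1)%R)%:E + f p.1)%E | p in
    [set p : X * dual X | Graph (subdiff f) p /\ (f p.1 <= f x + eps%:E)%E]].

End ConvexAnalysis.

Arguments Gamma {R} X.

(* Main.v *)
(* The upper bound [smile eps f <= f] is immediate, so everything is about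
   producing subgradients.  Two devices turn a function in [Gamma] into another
   one whose subgradients control those of f.

   Composing with the barrier u |-> u - sqrt (m - u) (+oo for u > m): since its
   slope is infinite at m and at least 1 below, every subgradient of the
   composite at a is a multiple, by a factor at least 1, of a subgradient of f
   at a, and f a < m.  (i) => (ii): by Hahn-Banach, any r < F x lies on an affine
   minorant of F = barrier o f with m = f x + eps; maximality of the
   subdifferential of F, applied to x and the slope of the minorant, gives a
   subgradient of F whose affine function is at least r at x, and the tangent
   inequality of the barrier transfers this to f.  (iv)' => (i): if (x, x') is
   monotonically related to the subdifferential of f and g = f - x' satisfies
   g y < m < g x, then barrier o g is at most m on its domain and is +oo at x, so
   some subgradient b' of g at some a has b' (x - a) > 0, a contradiction.

   Inf-convolving with a linear function on a segment: for f x = +oo and x0 in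
   the domain, g y = min over 0 <= s <= 1 of f (y - s (x - x0)) + s c is finite at
   x and g x tends to +oo with c; subgradients of g at y are subgradients of f at
   the minimizing point, which yields (iii)' => (iv)'. *)
From HB Require Import structures.
Require Import Defs.
From mathcomp Require Import ring lra.
Import Order.TTheory GRing.Theory Num.Theory.
Import numFieldNormedType.Exports.
Set Implicit Arguments.
Unset Strict Implicit.
Unset Printing Implicit Defensive.
Local Open Scope classical_set_scope.
Local Open Scope ring_scope.

(** * Convex neighbourhoods, and affine functions bounded below *)

Lemma convex_nbhs (R : realType) (X : tvsType R) (x : X) (V : set X) :
  nbhs x V -> exists2 U : set X, nbhs x U & U `<=` V /\
    forall u v t, U u -> U v -> 0 < t -> t < 1 -> U (t *: u + (1 - t) *: v).
Proof.
move=> xV.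
have [B Bc [Bo Bb]] := @locally_convex R X.
have [U [BU Ux] UV] := Bb x V xV.
exists U; first by apply: open_nbhs_nbhs; split => //; exact: Bo.
split=> // u v t Uu Uv t0 t1.
have t01 : Itv.spec (@Itv.num_sem R) (Itv.Real `[0%Z, 1%Z]) t.
  by rewrite /Itv.spec/= /Itv.num_sem /= num_real in_itv/= (ltW t0) (ltW t1).
have := Bc U (mem_set BU) u v (Itv.Def t01) (mem_set Uu) (mem_set Uv).
by rewrite inE.
Qed.

Lemma affine_ge0_slope0 (R : realFieldType) (c : R) (d : R) :
  (forall t, 0 <= c + t * d) -> d = 0.
Proof.
move=> h; apply/eqP/negPn/negP => d0.
by have := h (- (c + 1) / d); rewrite divfK //; lra.
Qed.

(** * Hahn-Banach theorem for convex sets in a product with the line *)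

Section HahnBanach.
Context {R : realType} {X : lmodType R}.
Implicit Type C : set (X * R).

Definition convex_graph C := forall p q (t : R), C p -> C q -> 0 < t -> t < 1 ->
  C (t *: p.1 + (1 - t) *: q.1, t * p.2 + (1 - t) * q.2).

Definition nonneg_at0 C := forall a, C (0, a) -> 0 <= a.

(** The slope [r] is the infimum of [a / t] over points (t x, a) of [C] with t > 0. It is finite and
    also works for t < 0, because a point over t x and one over -s x combine, with weight
    [s / (s + t)], into a point over 0. *)
Lemma convex_slope C x : convex_graph C -> nonneg_at0 C ->
  (forall y, exists a, C (y, a)) ->
  exists r : R, forall t a, C (t *: x, a) -> t * r <= a.
Proof.
move=> cC C0 fib.
pose A := [set b | exists t a : R, [/\ 0 < t, C (t *: x, a) & b = a / t]].
have lbA (s b : R) : 0 < s -> C (- s *: x, b) -> lbound A (- b / s).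
  move=> s0 Csb _ [t [a [t0 Cta ->]]].
  have st0 : 0 < s + t by rewrite addr_gt0.
  have := cC _ _ (s / (s + t)) Cta Csb.
  rewrite divr_gt0 // ltr_pdivrMr // mul1r ltrDl t0 => /(_ isT isT) /=.
  have -> : (s / (s + t)) *: (t *: x) + (1 - s / (s + t)) *: (- s *: x) = 0.
    rewrite !scalerA -scalerDl.
    have -> : s / (s + t) * t + (1 - s / (s + t)) * - s = 0.
      by field; rewrite gt_eqF.
    exact: scale0r.
  move/C0.
  have -> : s / (s + t) * a + (1 - s / (s + t)) * b = (s * a + t * b) / (s + t).
    by field; rewrite gt_eqF.
  rewrite pmulr_lge0 ?invr_gt0 // => h.
  rewrite ler_pdivrMr // mulrAC ler_pdivlMr //; nra.
have [a1 Ca1] := fib x; have [b1 Cb1] := fib (- x).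
have infA : has_inf A.
  split; first by exists (a1 / 1), 1, a1; rewrite scale1r.
  by exists (- b1 / 1); apply: lbA => //; rewrite scaleN1r.
exists (inf A) => t a Cta.
have [t0|t0|t0] := ltgtP t 0.
- have : - a / - t <= inf A.
    by apply: lb_le_inf (infA.1) _; apply: lbA; rewrite ?oppr_gt0 // opprK.
  by rewrite ler_pdivrMr ?oppr_gt0 // mulrN lerNl opprK mulrC.
- have : inf A <= a / t by apply: ge_inf; [exact: infA.2|exists t, a].
  by rewrite ler_pdivlMr // mulrC.
- by move: Cta; rewrite t0 scale0r mul0r => /C0.
Qed.

(* A maximal convex set above the origin is invariant under translation along
   a line (y, r) over every direction y, and these lines form the graph of a
   linear functional. *)
Lemma Hahn_Banach_convex C0 : convex_graph C0 -> nonneg_at0 C0 ->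
  (forall y, exists a, C0 (y, a)) ->
  exists L : X -> R, [/\ forall x y, L (x + y) = L x + L y,
    forall s x, L (s *: x) = s * L x & forall y a, C0 (y, a) -> L y <= a].
Proof.
move=> cC0 pC0 fib.
(* Forming the union with [C0] inside [P] lets the empty chain satisfy the hypothesis of Zorn's
   lemma. *)
pose P A := convex_graph (A `|` C0) /\ nonneg_at0 (A `|` C0).
have [|A [[cC pC] Amax]] := @Zorn_bigcup _ P.
  move=> F FP Ftot; split.
    move=> p q t [[A FA Ap]|Cp] [[B FB Bq]|Cq] t0 t1.
    - have [AB|BA] := Ftot _ _ FA FB.
        have [h|h] := (FP _ FB).1 p q t (or_introl (AB _ Ap)) (or_introl Bq) t0 t1.
          by left; exists B.
        by right.
      have [h|h] := (FP _ FA).1 p q t (or_introl Ap) (or_introl (BA _ Bq)) t0 t1.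
        by left; exists A.
      by right.
    - have [h|h] := (FP _ FA).1 p q t (or_introl Ap) (or_intror Cq) t0 t1.
        by left; exists A.
      by right.
    - have [h|h] := (FP _ FB).1 p q t (or_intror Cp) (or_introl Bq) t0 t1.
        by left; exists B.
      by right.
    - by right; exact: cC0.
  move=> a [[A FA Aa]|]; last exact: pC0.
  by apply: (FP _ FA).2; left.
set C := A `|` C0 in cC pC.
have fibC y : exists a, C (y, a) by have [a] := fib y; exists a; right.
have slope x : exists r : R,
    forall t y a, C (y, a) -> C (y + t *: x, a + t * r).
  have [r hr] := convex_slope x cC pC fibC; exists r.
  (* [C'] is [C] swept along the line spanned by (x, r). The choice of [r] keeps it nonnegative over
     0, so maximality forces [C'] to equal [C]. *)
  pose C' := [set p : X * R | exists t, C (p.1 + t *: x, p.2 + t * r)].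
  have CC' : C `<=` C'.
    by move=> [y a] Cya; exists 0; rewrite /= scale0r mul0r !addr0.
  have PC' : P C'.
    rewrite /P (setUidl (subset_trans _ CC')); last by move=> ? ?; right.
    split.
      move=> p q t [s1 h1] [s2 h2] t0 t1; exists (t * s1 + (1 - t) * s2) => /=.
      have := cC _ _ _ h1 h2 t0 t1 => /=.
      rewrite !scalerDr !scalerA !scalerDl addrACA.
      by congr (C (_, _)); ring.
    by move=> a [t]; rewrite /= add0r => /hr; lra.
  have C'C : C' `<=` C.
    apply: contrapT => C'C; apply: (Amax C') => //; split.
      by apply: subset_trans CC' => ? ?; left.
    by move=> C'A; apply: C'C => z /C'A; left.
  move=> t y a Cya; apply: C'C; exists (- t) => /=.
  by rewrite scaleNr mulNr !addrK.
pose L x := sval (cid (slope x)).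
have LC x t y a : C (y, a) -> C (y + t *: x, a + t * L x).
  exact: (svalP (cid (slope x))).
(* Translations of (0, c) forming a closed loop in [X] end at height c + t δ, where δ is the defect
   of linearity. Nonnegativity for all t gives δ = 0. *)
have [c Cc] := fibC 0.
exists L; split.
- move=> x y; apply/eqP; rewrite eq_sym -subr_eq0; apply/eqP.
  apply: (@affine_ge0_slope0 _ c) => t.
  have := pC _ _; apply.
  have := LC (x + y) (- t) _ _ (LC y t _ _ (LC x t _ _ Cc)).
  rewrite add0r -scalerDr scaleNr subrr.
  by congr (C (_, _)); ring.
- move=> s x; apply/eqP; rewrite eq_sym -subr_eq0; apply/eqP.
  apply: (@affine_ge0_slope0 _ c) => t.
  apply: pC; have := LC (s *: x) (- t) _ _ (LC x (t * s) _ _ Cc).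
  rewrite add0r -scalerA scaleNr subrr.
  by congr (C (_, _)); ring.
- move=> y a Ca; rewrite -subr_ge0; apply: pC.
  have := LC y (- 1) y a (or_intror Ca).
  by rewrite scaleN1r subrr mulN1r.
Qed.

End HahnBanach.

(** * Continuous linear functionals and neighbourhood calculus *)

Section Dual.
Context {R : realType} {X : tvsType R}.
Implicit Types (V U : set X) (x y z : X).

Lemma ex_dual (L : X -> R) : (forall x y, L (x + y) = L x + L y) ->
  (forall s x, L (s *: x) = s * L x) -> continuous L ->
  exists x' : dual X, forall z, x' z = L z.
Proof.
move=> LD LZ cL.
have lin : scalar L by move=> s x y; rewrite LD LZ.
pose L' : {scalar X} := HB.pack L (GRing.isLinear.Build _ _ _ _ L lin).
by exists (@Dual R X L' cL).
Qed.

Lemma dual_comb (s t : R) (x' y' : dual X) :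
  exists z' : dual X, forall z, z' z = s * x' z + t * y' z :> R.
Proof.
apply: (@ex_dual (fun z => s * x' z + t * y' z)).
- by move=> x y; rewrite !linearD /=; ring.
- by move=> k x; rewrite !linearZ /=; ring.
- move=> x; apply: cvgD; apply: cvgM; first exact: cvg_cst.
  + exact: dual_continuous.
  + exact: cvg_cst.
  + exact: dual_continuous.
Qed.

Lemma near_affine x y V : nbhs (x + y) V -> \forall z \near y, V (x + z).
Proof.
move=> xV.
have : (fun z : X => x + z) @ y --> x + y.
  apply: (@continuous_comp X (X * X)%type X (fun z => (x, z))
    (fun p : X * X => p.1 + p.2)); last exact: add_continuous.
  by apply: cvg_pair; [exact: cvg_cst | exact: cvg_id].
exact.
Qed.

Lemma near_scale (s : R) y V : nbhs (s *: y) V -> \forall z \near y, V (s *: z).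
Proof.
move=> xV.
have : (fun z : X => s *: z) @ y --> s *: y.
  apply: (@continuous_comp X (R^o * X)%type X (fun z => (s, z))
    (fun p : R^o * X => p.1 *: p.2)); last exact: scale_continuous.
  by apply: (@cvg_pair _ _ _ _ (nbhs (s : R^o)));
    [exact: cvg_cst | exact: cvg_id].
exact.
Qed.

Lemma near_line x y (s : R) V :
  nbhs (x + s *: y) V -> \forall t \near s & z \near x, V (z + t *: y).
Proof.
move=> xV.
have : (fun p : R * X => p.2 + p.1 *: y) @ filter_prod (nbhs s) (nbhs x)
    --> x + s *: y.
  apply: (@cvg_comp _ _ _ (fun p : R * X => (p.2, p.1 *: y))
    (fun p : X * X => p.1 + p.2) _ (nbhs (x, s *: y))); last first.
    exact: (@add_continuous X (x, s *: y)).
  apply: cvg_pair; first exact: cvg_snd.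
  apply: (@cvg_comp _ _ _ (fun p : R * X => (p.1 : R^o, y))
    (fun p : R^o * X => p.1 *: p.2) _ (nbhs ((s : R^o), y))); last first.
    exact: (@scale_continuous R X (s, y)).
  apply: (@cvg_pair _ _ _ _ (nbhs (s : R^o))); last exact: cvg_cst.
  exact: cvg_fst.
by move/(_ V xV).
Qed.

Lemma absorbing U x : nbhs 0 U -> exists2 r : R, 0 < r & U (r^-1 *: x).
Proof.
move=> U0.
have : \forall t \near (0 : R) & z \near (0 : X), U (z + t *: x).
  by apply: near_line; rewrite scale0r addr0.
move=> [[A B] [A0 B0] AB].
have [e /= e0 eA] := A0.
exists (e / 2)^-1; first by rewrite invr_gt0 divr_gt0.
rewrite invrK -[_ *: x]add0r; apply: (AB (e / 2, 0)); split => /=.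
  by apply: eA; rewrite /= sub0r normrN gtr0_norm ?divr_gt0 //; lra.
exact: nbhs_singleton.
Qed.

(** With a positive bound [M] on [U], the increments z - x for which both k (z - x) and -k (z - x)
    lie in [U], k = M / e, satisfy |L (z - x)| <= e. *)
Lemma linear_bounded_above_continuous (L : X -> R) (K : R) U :
  (forall x y, L (x + y) = L x + L y) -> (forall s x, L (s *: x) = s * L x) ->
  nbhs 0 U -> (forall u, U u -> L u <= K) -> continuous L.
Proof.
move=> LD LZ U0 UK.
have UK' u : U u -> L u <= `|K| + 1.
  by move=> /UK h; apply: (le_trans h); rewrite (le_trans (ler_norm K)) // lerDl.
move: (`|K| + 1) (ltr_wpDl (normr_ge0 K) (@ltr01 R)) UK' => M M0 UM x.
apply/cvgrPdist_le => /= e e0.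
pose k := M / e.
have k0 : 0 < k by rewrite divr_gt0.
have small : \forall z \near x, U (k *: (z - x)) /\ U (- k *: (z - x)).
  have aux (s : R) : \forall z \near x, U (s *: (z - x)).
    have : \forall z \near x, U (s *: (- x + z)).
      apply: (@near_affine (- x) x (fun v => U (s *: v))).
      by rewrite addNr; apply: near_scale; rewrite scaler0.
    by apply: filterS => z; rewrite addrC.
  by apply: filterI; exact: aux.
apply: filterS small => z [/UM + /UM]; rewrite !LZ => h1 h2.
have -> : L x - L z = - L (z - x).
  by rewrite LD -(scaleN1r x) LZ; ring.
rewrite normrN ler_norml; move: (L (z - x)) h1 h2 => l h1 h2.
have ke : k * e = M by rewrite divfK // gt_eqF.
by apply/andP; split; rewrite -(ler_pM2l k0) ?mulrN ke //; lra.
Qed.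

End Dual.

(** * The class Γ and affine minorants *)

Section GammaTheory.
Context {R : realType} {X : tvsType R}.
Implicit Types (f : X -> \bar R) (x y z : X).

(** Convexity of the epigraph, phrased through real upper bounds to avoid infinite arithmetic. *)
Definition convex_epi f := forall x y (a b t : R), (f x <= a%:E)%E ->
  (f y <= b%:E)%E -> 0 < t -> t < 1 ->
  (f (t *: x + (1 - t) *: y)%R <= (t * a + (1 - t) * b)%:E)%E.

Lemma le_EFin_fin (e : \bar R) (a : R) : e <> -oo%E -> (e <= a%:E)%E ->
  exists b : R, e = b%:E.
Proof. by case: e => // b _ _; exists b. Qed.

Lemma GammaP f : Gamma X f <->
  [/\ proper_fun f, convex_epi f & lower_semicontinuous f].
Proof.
split=> -[[f0 fNy] fc fl]; split=> //.
- move=> x y a b t fa fb t0 t1; apply: (le_trans (fc _ _ _ t0 t1)).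
  have [r fx] := le_EFin_fin (fNy x) fa; have [s fy] := le_EFin_fin (fNy y) fb.
  rewrite fx fy; move: fa fb; rewrite fx fy !lee_fin => ra sb.
  change ((t * r + (1 - t) * s)%:E <= (t * a + (1 - t) * b)%:E)%E; rewrite lee_fin.
  by rewrite lerD // ler_wpM2l // ?subr_ge0 ltW.
- move=> x y t t0 t1; have t1' : 0 < 1 - t by rewrite subr_gt0.
  have ooE (u : R) : 0 < u -> (u%:E * +oo)%E = +oo%E :> \bar R.
    by move=> u0; rewrite gt0_muley ?lte_fin.
  have ooD (e : \bar R) : dual_adde +oo%E e = +oo%E by case: e.
  case fx : (f x) (fNy x) => [r||] // _; last first.
    change (f (t *: x + (1 - t) *: y)%R <= dual_adde (t%:E * +oo) ((1 - t)%:E * f y))%E.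
    by rewrite ooE // ooD leey.
  case fy : (f y) (fNy y) => [s||] // _; last first.
    change (f (t *: x + (1 - t) *: y)%R <= dual_adde (t%:E * r%:E) ((1 - t)%:E * +oo))%E.
    by rewrite ooE //= leey.
  by apply: fc; rewrite ?fx ?fy.
Qed.

Lemma Gamma_gtNy f x : Gamma X f -> (-oo < f x)%E.
Proof. by move=> [[_ fN] _ _]; rewrite ltNye; apply/eqP. Qed.

Lemma Gamma_fin f x : Gamma X f -> edom f x -> exists a : R, f x = a%:E.
Proof.
move=> /(Gamma_gtNy x); rewrite /edom /=.
by case: (f x) => // a _ _; exists a.
Qed.

Lemma subdiffP f x (x' : dual X) (a : R) : f x = a%:E ->
  (forall y (b : R), (f y <= b%:E)%E -> a + x' (y - x) <= b) ->
  subdiff f x x'.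
Proof.
move=> fx h; split; rewrite fx // => y.
case E : (f y) => [b||]; rewrite ?leey //.
  by rewrite lee_fin; apply: h; rewrite E.
have := h y (a + x' (y - x) - 1); rewrite E leNye => /(_ isT) k.
by exfalso; clear -k; lra.
Qed.

Lemma subdiff_le f x (x' : dual X) (a b : R) y : subdiff f x x' ->
  f x = a%:E -> (f y <= b%:E)%E -> a + x' (y - x) <= b.
Proof. by move=> [_ h] fx fy; have := le_trans (h y) fy; rewrite fx lee_fin. Qed.

(** Hahn-Banach is applied to [C], the epigraph of f translated by (-x, -r) plus the cone of the
    points (k u, K k) with u in [U] and k > 0. The cone makes the functional bounded above on [U],
    hence continuous, and it disappears as k tends to 0. *)
Lemma affine_minorant f x (r : R) : Gamma X f -> edom f x -> (r%:E < f x)%E ->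
  exists x' : dual X, forall z (a : R), (f z <= a%:E)%E -> r + x' (z - x) <= a.
Proof.
move=> fG fx rfx; have [c fxc] := Gamma_fin fG fx.
have /GammaP[_ fc fl] := fG.
have rc : r < c by move: rfx; rewrite fxc lte_fin.
have [V xV Vf] := fl x r rfx.
have V0 : \forall u \near (0 : X), V (x - u).
  have : \forall u \near (0 : X), V (x + (-1) *: u).
    apply: (@near_scale _ _ (-1) 0 (fun v => V (x + v))).
    by apply: near_affine; rewrite scaler0 addr0.
  by apply: filterS => u; rewrite scaleN1r.
have [U U0 [UV Uc]] := convex_nbhs V0.
have Uf u : U u -> (r%:E < f (x - u)%R)%E by move=> /UV; exact: Vf.
have U00 : U 0 by exact: nbhs_singleton.
pose K := c - r; have K0 : 0 < K by rewrite subr_gt0.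
pose C := [set p : X * R | exists z a k, [/\ (f z <= a%:E)%E, 0 < k,
  U (k^-1 *: (p.1 - (z - x))) & p.2 = a - r + K * k]].
have cC : convex_graph C.
  move=> [w1 b1] [w2 b2] t [z1 [a1 [k1 [f1 k10 U1 /= ->]]]].
  move=> [z2 [a2 [k2 [f2 k20 U2 /= ->]]]] t0 t1.
  have t1' : 0 < 1 - t by rewrite subr_gt0.
  exists (t *: z1 + (1 - t) *: z2), (t * a1 + (1 - t) * a2).
  exists (t * k1 + (1 - t) * k2).
  have kt0 : 0 < t * k1 + (1 - t) * k2 by rewrite addr_gt0 // mulr_gt0.
  split=> //=; last by ring.
    exact: fc.
  (* Weight for which the two points of [U] combine into the rescaled point of the convex
     combination. *)
  pose s := t * k1 / (t * k1 + (1 - t) * k2).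
  have s0 : 0 < s by rewrite divr_gt0 // mulr_gt0.
  have s1 : s < 1 by rewrite ltr_pdivrMr // mul1r ltrDl mulr_gt0.
  have := Uc _ _ s U1 U2 s0 s1 => /=; rewrite !scalerA.
  have -> : s / k1 = (t * k1 + (1 - t) * k2)^-1 * t.
    by rewrite /s; field; rewrite !gt_eqF.
  have -> : (1 - s) / k2 = (t * k1 + (1 - t) * k2)^-1 * (1 - t).
    by rewrite /s; field; rewrite !gt_eqF.
  rewrite -!scalerA -scalerDr; congr (U (_ *: _)).
  rewrite !scalerBr addrACA -opprD [X in _ - X]addrACA -opprD -scalerDl.
  by rewrite [t + _]addrC subrK scale1r.
have pC : nonneg_at0 C.
  move=> b [z [a [k [fz k0 Uz /= ->]]]].
  set u := k^-1 *: _ in Uz.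
  have kuE : k *: u = x - z by rewrite scalerA divff ?gt_eqF // scale1r sub0r opprB.
  (* Here z = x - k u. If k <= 1, then z lies in x - U, where f > r. If k > 1, then x - u lies
     between z and x, and convexity bounds f z from below; [K] = c - r absorbs the loss. *)
  have [k1|k1] := leP k 1.
    have : U (k *: u).
      move: k1; rewrite le_eqVlt => /predU1P[->|k1]; first by rewrite scale1r.
      by rewrite -[_ *: _]addr0 -[X in _ + X](scaler0 _ (1 - k)); apply: Uc.
    move=> /Uf; rewrite kuE subKr => /lt_le_trans/(_ fz); rewrite lte_fin => ra.
    by rewrite addr_ge0 ?subr_ge0 ?ltW // mulr_gt0.
  have ki1 : k^-1 < 1 by rewrite invf_lt1.
  have := fc z x a c k^-1 fz; rewrite fxc invr_gt0 => /(_ (lexx _) k0 ki1).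
  have -> : k^-1 *: z + (1 - k^-1) *: x = x - u.
    have -> : u = k^-1 *: (x - z).
      by rewrite -kuE scalerA mulVf ?gt_eqF // scale1r.
    by rewrite scalerBl scale1r scalerBr opprB addrCA.
  move=> /(lt_le_trans (Uf _ Uz)); rewrite lte_fin => h.
  have := ltW h; rewrite -(ler_pM2l k0) => {}h.
  suff : k * r <= a + (k - 1) * c by rewrite /K; nra.
  apply: (le_trans h); rewrite le_eqVlt; apply/orP; left; apply/eqP.
  by field; rewrite gt_eqF.
have fib y : exists a, C (y, a).
  have [k k0 Uk] := absorbing y U0.
  by exists (c - r + K * k), x, c, k; split=> //=; rewrite ?fxc // subrr subr0.
have [L [LD LZ LC]] := Hahn_Banach_convex cC pC fib.
have [|x' x'L] := ex_dual LD LZ.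
  apply: (linear_bounded_above_continuous LD LZ U0 (K := c - r + K * 1)) => u Uu.
  apply: LC; exists x, c, 1; split=> //; first by rewrite fxc.
  by rewrite /= subrr subr0 invr1 scale1r.
exists x' => z a fz; rewrite x'L.
(* Let k tend to 0: the instance used makes [K * k] half of the supposed excess. *)
suff : forall k, 0 < k -> L (z - x) <= a - r + K * k.
  move=> h; rewrite leNgt; apply/negP => lt.
  have := h ((L (z - x) + r - a) / (2 * K)).
  rewrite divr_gt0 ?mulr_gt0 //; last by lra.
  have -> : K * ((L (z - x) + r - a) / (2 * K)) = (L (z - x) + r - a) / 2.
    by field; rewrite gt_eqF.
  by move=> /(_ isT); lra.
move=> k k0; apply: LC; exists z, a, k; split=> //=.
by rewrite subrr scaler0.
Qed.

End GammaTheory.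

(** * Real analysis of the barrier *)

Section Barrier.
Context {R : realType}.
Implicit Types (m u v t p q : R).

(** Beyond m the square root is 0 and the formula is the identity, so monotonicity holds on the
    whole line. *)
Definition barrier m u := u - Num.sqrt (m - u).
(** The derivative of the barrier for u < m; for u >= m it takes the default value 1, as the inverse
    of 0 is 0. *)
Definition barrier_slope m u := 1 + (2 * Num.sqrt (m - u))^-1.

Lemma barrier_le m u : barrier m u <= u.
Proof. by rewrite lerBlDr lerDl sqrtr_ge0. Qed.

Lemma barrier_homo m u v : u <= v -> barrier m u <= barrier m v.
Proof.
move=> uv; rewrite /barrier lerB //.
by apply: ler_wsqrtr; lra.
Qed.

(** Concavity of the square root: after squaring, the sides differ by
    [t * (1 - t) * (a - b) ^+ 2]. *)
Lemma barrier_convex m u v t : u <= m -> v <= m -> 0 < t -> t < 1 ->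
  barrier m (t * u + (1 - t) * v) <= t * barrier m u + (1 - t) * barrier m v.
Proof.
move=> um vm t0 t1; rewrite /barrier.
suff : t * Num.sqrt (m - u) + (1 - t) * Num.sqrt (m - v) <=
  Num.sqrt (m - (t * u + (1 - t) * v)) by lra.
have := sqr_sqrtr (_ : 0 <= m - u); have := sqr_sqrtr (_ : 0 <= m - v).
rewrite !subr_ge0 => /(_ vm) + /(_ um).
move: (sqrtr_ge0 (m - u)) (sqrtr_ge0 (m - v)).
move: (Num.sqrt (m - u)) (Num.sqrt (m - v)) => a b a0 b0 hb ha.
have h0 : 0 <= t * a + (1 - t) * b by rewrite addr_ge0 // mulr_ge0 //; lra.
rewrite -(ger0_norm h0) -sqrtr_sqr; apply: ler_wsqrtr.
have : 0 <= t * (1 - t) * (a - b) ^+ 2 by rewrite mulr_ge0 ?sqr_ge0 // mulr_ge0; lra.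
nra.
Qed.

Lemma barrier_slope_ge1 m u : 1 <= barrier_slope m u.
Proof. by rewrite lerDl invr_ge0 mulr_ge0 // sqrtr_ge0. Qed.

Lemma barrier_tangent m u v : u < m -> v <= m ->
  barrier m u + barrier_slope m u * (v - u) <= barrier m v.
Proof.
move=> um vm; rewrite /barrier /barrier_slope.
have s0 : 0 < Num.sqrt (m - u) by rewrite sqrtr_gt0 subr_gt0.
have := sqr_sqrtr (_ : 0 <= m - v); rewrite subr_ge0 => /(_ vm).
have := sqr_sqrtr (_ : 0 <= m - u); rewrite subr_ge0 => /(_ (ltW um)).
move: (Num.sqrt (m - u)) (Num.sqrt (m - v)) s0 => s r s0 hs hr.
have -> : v - u = s ^+ 2 - r ^+ 2 by lra.
(* Multiplied by 2 s, this is (s - r)^2 >= 0. *)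
suff : (2 * s)^-1 * (s ^+ 2 - r ^+ 2) <= s - r by lra.
rewrite mulrC ler_pdivrMr ?mulr_gt0 //.
by have := sqr_ge0 (s - r); nra.
Qed.

Lemma barrier_left_cont m u a : a < barrier m u -> exists2 v, v < u & a < barrier m v.
Proof.
move=> au; pose e := barrier m u - a.
have e0 : 0 < e by rewrite subr_gt0.
(* Lowering u by w^2 costs at most w^2 + w <= 2 e / 3. *)
pose w := Num.min 1 (e / 3).
have w0 : 0 < w by rewrite lt_min ltr01 divr_gt0.
have w1 : w <= 1 by rewrite ge_min lexx.
have we : w <= e / 3 by rewrite ge_min lexx orbT.
exists (u - w ^+ 2); first by rewrite ltrBlDr ltrDl exprn_gt0.
suff : Num.sqrt (m - (u - w ^+ 2)) <= Num.sqrt (m - u) + w.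
  have : w ^+ 2 <= w by nra.
  by move: we; rewrite /e /barrier; lra.
have h : 0 <= Num.sqrt (m - u) + w by rewrite addr_ge0 ?sqrtr_ge0 // ltW.
rewrite -[leRHS](ger0_norm h) -sqrtr_sqr; apply: ler_wsqrtr.
have mu : m - u <= Num.sqrt (m - u) ^+ 2.
  have [mu0|mu0] := leP 0 (m - u); first by rewrite sqr_sqrtr.
  by apply: (le_trans (ltW mu0)); rewrite sqr_ge0.
have := sqrtr_ge0 (m - u); move: (Num.sqrt _) mu => s mu s0.
nra.
Qed.

(** The drop sqrt (t q) is not linear in t: squaring the inequality gives q <= t (p + q)^2, which
    the chosen [t] violates. *)
Lemma barrier_no_slope m p q : 0 < q ->
  ~ forall t, 0 < t -> t < 1 -> m + t * p <= barrier m (m - t * q).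
Proof.
move=> q0 h; pose P := (p + q) ^+ 2.
have P0 : 0 <= P by rewrite sqr_ge0.
pose t := q / (q + P + 1).
have D0 : 0 < q + P + 1 by lra.
have t0 : 0 < t by rewrite divr_gt0.
have t1 : t < 1 by rewrite ltr_pdivrMr // mul1r; lra.
have tP : t * P < q by rewrite mulrAC ltr_pdivrMr // ltr_pM2l //; lra.
have := h t t0 t1; rewrite /barrier subKr => {}h.
have tq0 : 0 <= t * q by rewrite mulr_ge0 // ltW.
have := sqr_sqrtr tq0; have := sqrtr_ge0 (t * q).
move: (Num.sqrt _) h => s h s0 ss.
have st : s <= - (t * (p + q)) by lra.
have : s ^+ 2 <= (- (t * (p + q))) ^+ 2 by rewrite lerXn2r // nnegrE // (le_trans s0).
rewrite ss sqrrN exprMn -/P expr2 -mulrA ler_pM2l //; lra.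
Qed.

(** Scaling reduces it to sqrt (1 - x) >= 1 - x/2 - x^2/2 for |x| <= 1; after squaring, the gap is a
    quarter of [(1 - x) * (x + 3) * x ^+ 2]. *)
Lemma sqrt_taylor_lb (s h : R) : 0 < s -> `|h| <= s ^+ 2 ->
  s - h / (2 * s) - h ^+ 2 / (2 * s ^+ 3) <= Num.sqrt (s ^+ 2 - h).
Proof.
move=> s0 hs; pose x := h / s ^+ 2.
have hE : h = x * s ^+ 2 by rewrite divfK // gt_eqF // exprn_gt0.
have x1 : `|x| <= 1.
  by rewrite normf_div (ger0_norm (sqr_ge0 s)) ler_pdivrMr ?exprn_gt0 // mul1r.
move: x1; rewrite ler_norml => /andP[x1 x2].
have -> : s - h / (2 * s) - h ^+ 2 / (2 * s ^+ 3) = s * (1 - x / 2 - x ^+ 2 / 2).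
  by rewrite hE; field; rewrite gt_eqF.
have -> : s ^+ 2 - h = s ^+ 2 * (1 - x) by rewrite hE; ring.
have x0 : 0 <= 1 - x / 2 - x ^+ 2 / 2 by nra.
rewrite sqrtrM ?sqr_ge0 // sqrtr_sqr gtr0_norm // ler_pM2l //.
rewrite -(ger0_norm x0) -sqrtr_sqr; apply: ler_wsqrtr.
have : 0 <= (1 - x) * (x + 3) * x ^+ 2.
  by rewrite mulr_ge0 ?sqr_ge0 // mulr_ge0; lra.
nra.
Qed.

Lemma barrier_deriv m u p q : u < m ->
  (forall t, 0 < t -> t < 1 -> u + t * q <= m ->
    barrier m u + t * p <= barrier m (u + t * q)) ->
  p <= barrier_slope m u * q.
Proof.
move=> um h; rewrite leNgt; apply/negP => lt.
pose s := Num.sqrt (m - u).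
have s0 : 0 < s by rewrite sqrtr_gt0 subr_gt0.
have ss : s ^+ 2 = m - u by rewrite sqr_sqrtr // subr_ge0 ltW.
pose D := p - barrier_slope m u * q; have D0 : 0 < D by rewrite subr_gt0.
pose C := q ^+ 2 / (2 * s ^+ 3).
have C0 : 0 <= C by rewrite divr_ge0 ?sqr_ge0 // mulr_ge0 // exprn_ge0 // ltW.
(* [D] is the supposed excess and [C] the second-order coefficient. The three summands of [N] make t
   = 1/N satisfy t < 1, t |q| <= s^2 and t C < D. *)
pose N := 2 + `|q| / s ^+ 2 + C / D.
have q0 : 0 <= `|q| / s ^+ 2 by rewrite divr_ge0 ?sqr_ge0.
have CD0 : 0 <= C / D by rewrite divr_ge0 // ltW.
have N0 : 0 < N by rewrite /N; lra.
pose t := N^-1; have t0 : 0 < t by rewrite invr_gt0.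
have t1 : t < 1 by rewrite invf_lt1 // /N; lra.
have tq : t * `|q| <= s ^+ 2.
  rewrite mulrC ler_pdivrMr // /N !mulrDr.
  have -> : s ^+ 2 * (`|q| / s ^+ 2) = `|q|.
    by field; rewrite gt_eqF.
  have : 0 <= s ^+ 2 * (C / D) by rewrite mulr_ge0 ?sqr_ge0.
  by have := sqr_ge0 s; lra.
have tC : t * C < D.
  rewrite mulrC ltr_pdivrMr // /N !mulrDr.
  have -> : D * (C / D) = C by field; rewrite gt_eqF.
  have : 0 <= D * (`|q| / s ^+ 2) by rewrite mulr_ge0 // ltW.
  lra.
have htq : `|t * q| <= s ^+ 2 by rewrite normrM gtr0_norm.
have tqm : u + t * q <= m.
  by move: htq; rewrite ss ler_norml => /andP[_]; lra.
have := h t t0 t1 tqm; rewrite /barrier.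
have -> : m - (u + t * q) = s ^+ 2 - t * q by rewrite ss; ring.
rewrite -/s; have := sqrt_taylor_lb s0 htq.
have -> : (t * q) ^+ 2 / (2 * s ^+ 3) = t * (t * C).
  by rewrite /C; field; rewrite gt_eqF.
have -> : t * q / (2 * s) = t * ((2 * s)^-1 * q) by field; rewrite gt_eqF.
move=> h1 h2.
have : t * p <= t * (q + (2 * s)^-1 * q + t * C) by rewrite !mulrDr; lra.
rewrite ler_pM2l // => h3.
by move: tC; rewrite /D /barrier_slope -/s mulrDl mul1r; lra.
Qed.

End Barrier.

(** * Composition with the barrier and its chain rule *)

Section BarrierComp.
Context {R : realType} {X : tvsType R}.
Implicit Types (f : X -> \bar R) (m u r : R) (x y z a : X).

Definition barrier_comp m f : X -> \bar R := fun z =>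
  if (f z <= m%:E)%E then (barrier m (fine (f z)))%:E else +oo%E.

Lemma barrier_compE m f z u : f z = u%:E -> u <= m ->
  barrier_comp m f z = (barrier m u)%:E.
Proof. by move=> fz um; rewrite /barrier_comp fz lee_fin um. Qed.

Lemma barrier_compy m f z : (m%:E < f z)%E -> barrier_comp m f z = +oo%E.
Proof. by move=> mf; rewrite /barrier_comp leNgt mf. Qed.

Lemma barrier_comp_ltyP m f z : Gamma X f -> (barrier_comp m f z < +oo)%E ->
  exists2 u, f z = u%:E & u <= m.
Proof.
move=> fG; rewrite /barrier_comp; case: ifPn => // fm _.
have [u fz] := Gamma_fin fG (le_lt_trans fm (ltey _)).
by exists u => //; rewrite fz lee_fin in fm.
Qed.

Lemma barrier_comp_leP m f z r : Gamma X f -> (barrier_comp m f z <= r%:E)%E ->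
  exists u, [/\ f z = u%:E, u <= m & barrier m u <= r].
Proof.
move=> fG fr; have [u fz um] := barrier_comp_ltyP fG (le_lt_trans fr (ltey _)).
by exists u; split=> //; rewrite (barrier_compE fz um) lee_fin in fr.
Qed.

Lemma barrier_comp_le m f z u : Gamma X f -> (f z <= u%:E)%E -> u <= m ->
  (barrier_comp m f z <= (barrier m u)%:E)%E.
Proof.
move=> fG fu um; have [v fz] := Gamma_fin fG (le_lt_trans fu (ltey _)).
move: fu; rewrite fz lee_fin => vu.
by rewrite (barrier_compE fz) ?lee_fin ?barrier_homo // (le_trans vu).
Qed.

Lemma barrier_comp_Gamma m f y : Gamma X f -> (f y <= m%:E)%E ->
  Gamma X (barrier_comp m f).
Proof.
move=> fG fy; have /GammaP[_ fc fl] := fG; apply/GammaP; split.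
- split; last by move=> z; rewrite /barrier_comp; case: ifP.
  by exists y; rewrite /edom /= /barrier_comp fy ltey.
- move=> x1 x2 r1 r2 t /(barrier_comp_leP fG)[u1 [f1 um1 ur1]].
  move=> /(barrier_comp_leP fG)[u2 [f2 um2 ur2]] t0 t1.
  have := fc x1 x2 u1 u2 t; rewrite f1 f2 => /(_ (lexx _) (lexx _) t0 t1).
  move=> /(barrier_comp_le fG)/(_ _)/le_trans; apply; first by nra.
  rewrite lee_fin (le_trans (barrier_convex um1 um2 t0 t1)) //.
  by rewrite lerD // ler_wpM2l //; lra.
- move=> x r rF.
  have [fm|mf] := leP (f x) m%:E; last first.
    have [V xV Vf] := fl x m mf; exists V => // z /Vf /barrier_compy ->.
    exact: ltey.
  have [u fx] := Gamma_fin fG (le_lt_trans fm (ltey _)).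
  rewrite fx lee_fin in fm.
  (* Near x, f exceeds some v < u with [barrier m v] > r; monotonicity of the barrier concludes. *)
  move: rF; rewrite (barrier_compE fx fm) lte_fin => /barrier_left_cont[v vu rv].
  have [|V xV Vf] := fl x v; first by rewrite fx lte_fin.
  exists V => // z /Vf vfz; rewrite ltNge; apply/negP.
  move=> /(barrier_comp_leP fG)[w [fz wm wr]].
  move: vfz; rewrite fz lte_fin => /ltW /(barrier_homo m).
  by move: rv wr; lra.
Qed.

(* Chain rule; the infinite slope of the barrier at [m] excludes [f a = m]. *)
Lemma subdiff_barrier_comp m f y a (a' : dual X) : Gamma X f ->
  (f y < m%:E)%E -> subdiff (barrier_comp m f) a a' ->
  exists u (b' : dual X), [/\ f a = u%:E, u < m, subdiff f a b' &
    forall z, a' z = barrier_slope m u * b' z].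
Proof.
move=> fG fy sa; have /GammaP[_ fc _] := fG.
have [u fa um] : exists2 u, f a = u%:E & u <= m.
  by apply: barrier_comp_ltyP => //; have := sa.1; rewrite fin_numElt => /andP[].
have Fa := barrier_compE fa um.
(* The subgradient inequality on the segment from a to z, with f replaced by its convex upper
   bound. *)
have key z (b t : R) : (f z <= b%:E)%E -> 0 < t -> t < 1 ->
    u + t * (b - u) <= m ->
    barrier m u + t * a' (z - a) <= barrier m (u + t * (b - u)).
  move=> fz t0 t1 h.
  have := fc z a b u t fz; rewrite fa => /(_ (lexx _) t0 t1).
  rewrite (_ : t * b + (1 - t) * u = u + t * (b - u)); last by ring.
  move=> /(barrier_comp_le fG)/(_ h)/(subdiff_le sa Fa).
  have -> : t *: z + (1 - t) *: a - a = t *: (z - a).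
    by rewrite scalerBl scale1r scalerBr addrCA [a + _]addrC addrK addrC.
  by rewrite linearZ.
have [v fyv] := Gamma_fin fG (lt_trans fy (ltey _)).
have vm : v < m by rewrite fyv lte_fin in fy.
have {}um : u < m.
  (* If f a = m, moving from a towards y would bound the slope of the barrier at m. *)
  rewrite lt_neqAle um andbT; apply/eqP => um'.
  apply: (@barrier_no_slope _ m (a' (y - a)) (m - v)); first by rewrite subr_gt0.
  move=> t t0 t1; have := key y v t; rewrite fyv um' => /(_ (lexx _) t0 t1).
  have -> : m + t * (v - m) = m - t * (m - v) by ring.
  rewrite {1}/barrier subrr sqrtr0 subr0; apply.
  by rewrite lerBlDr lerDl mulr_ge0 ?subr_ge0 // ltW.
have k0 : barrier_slope m u != 0.
  by rewrite gt_eqF // (lt_le_trans ltr01) // barrier_slope_ge1.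
have [b' b'E] := dual_comb (barrier_slope m u)^-1 0 a' a'.
exists u, b'; split=> //; last first.
  by move=> z; rewrite b'E mul0r addr0 mulrA divff // mul1r.
apply: (subdiffP fa) => z b fz; rewrite b'E mul0r addr0.
have := barrier_deriv um (fun t => @key z b t fz).
have := barrier_slope_ge1 m u.
move: (barrier_slope m u) (a' _) k0 => k p k0 k1.
rewrite -(ler_pM2l (_ : 0 < k^-1)) ?invr_gt0 ?(lt_le_trans ltr01) //.
by rewrite mulrA mulVf // mul1r; lra.
Qed.

End BarrierComp.

(** * Inf-convolution along a segment *)

Section SegmentInfConvolution.
Context {R : realType} {X : tvsType R}.
Implicit Types (f : X -> \bar R) (c s r : R) (d x y z : X).

Lemma lt_ereal_dense (r : R) (e : \bar R) : (r%:E < e)%E ->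
  exists2 b, r < b & (b%:E < e)%E.
Proof.
case: e => [v||]; rewrite ?lte_fin // => rv; last first.
  by exists (r + 1); rewrite ?ltry // ltrDl.
by exists ((r + v) / 2); rewrite ?lte_fin; lra.
Qed.

Definition segconv f d c : X -> \bar R := fun y =>
  ereal_inf [set (f (y - s *: d)%R + (s * c)%:E)%E | s in `[0, 1]].

Lemma segconv_le f d c y s : 0 <= s -> s <= 1 ->
  (segconv f d c y <= f (y - s *: d)%R + (s * c)%:E)%E.
Proof.
by move=> s0 s1; apply: ereal_inf_lbound; exists s => //=; rewrite in_itv /= s0.
Qed.

Lemma le_segconv f d c y e :
  (forall s, 0 <= s -> s <= 1 -> (e <= f (y - s *: d)%R + (s * c)%:E)%E) ->
  (e <= segconv f d c y)%E.
Proof.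
move=> h; apply: le_ereal_inf_tmp => _ [s /= + <-]; rewrite in_itv /= => /andP[].
exact: h.
Qed.

(** A tube argument from compactness of [0, 1]. The bound b is a second parameter tending to r from
    the right, so the covering property supplies it together with the neighbourhood. *)
Lemma near_segment f d c y r : lower_semicontinuous f ->
  (forall s, 0 <= s -> s <= 1 -> (r%:E < f (y - s *: d)%R + (s * c)%:E)%E) ->
  exists2 b, r < b & \forall z \near y, forall s, 0 <= s -> s <= 1 ->
    (b%:E < f (z - s *: d)%R + (s * c)%:E)%E.
Proof.
move=> fl h.
have /compact_near_coveringP cov := @segment_compact R 0 1.
pose P (i : X * R) s := (i.2%:E < f (i.1 - s *: d)%R + (s * c)%:E)%E.
have [|[A B] [yA rB] AB] := cov (X * R)%type (filter_prod (nbhs y) (at_right r)) P _.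
  move=> s; rewrite /= in_itv /= => /andP[s0 s1].
  have [b rb bf] : exists2 b, r - s * c < b & (b%:E < f (y - s *: d)%R)%E.
    apply: lt_ereal_dense; rewrite EFinB lteBlDr //; exact: h.
  (* The slack [e] is shared equally between the variation of s c and that of the bound. *)
  pose e := b - (r - s * c); have e0 : 0 < e by rewrite subr_gt0.
  have [V yV Vf] := fl _ _ bf.
  have [|[C D] [/= sC yD] CD] := @near_line _ _ y (- d) s V.
    by rewrite scalerN.
  have sc : \forall t \near s, `|s * c - t * c| < e / 2.
    have /cvgrPdist_lt : (fun t => t * c) @ s --> s * c.
      by apply: cvgM; [exact: cvg_id|exact: cvg_cst].
    by apply; rewrite divr_gt0.
  exists (C `&` [set t | `|s * c - t * c| < e / 2],
    D `*` [set b' | b' < r + e / 2]) => /=.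
    split; first exact: filterI.
    exists (D, [set b' | b' < r + e / 2]) => //=; split=> //.
    by apply: nbhs_right_lt; rewrite ltrDl divr_gt0.
  move=> [t [z b']] /= [[Ct tc] [Dz br]]; rewrite /P /=.
  have /Vf : V (z - t *: d) by rewrite -scalerN; exact: (CD (t, z)).
  rewrite -lteBlDr // -EFinB; apply: lt_trans; rewrite lte_fin.
  by move: tc; rewrite ltr_norml => /andP[]; rewrite /e in br *; lra.
have [b [Bb rb]] : exists b, B b /\ r < b.
  by have := filter_ex (filterI rB (nbhs_right_gt r)); case=> b [? ?]; exists b.
exists b => //; apply: filterS yA => z Az s s0 s1.
by apply: (AB (z, b)); rewrite //= in_itv /= s0.
Qed.

(** An affine minorant excludes -oo. If a finite infimum m were not attained, all values would
    exceed m and [near_segment] would give a larger lower bound. *)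
Lemma segconv_attained f d c y : Gamma X f ->
  exists s, [/\ 0 <= s, s <= 1 & segconv f d c y = (f (y - s *: d)%R + (s * c)%:E)%E].
Proof.
move=> fG; have /GammaP[[[x0 fx0] _] _ fl] := fG.
have [a fa] := Gamma_fin fG fx0.
have [|x' x'P] := @affine_minorant _ _ f x0 (a - 1) fG fx0.
  by rewrite fa lte_fin; lra.
have gNy : segconv f d c y != -oo%E.
  pose M := a - 1 + x' (y - x0) - `|x' d| - `|c|.
  suff : (M%:E <= segconv f d c y)%E by move=> h; apply/eqP => E; rewrite E in h.
  apply: le_segconv => s s0 s1; rewrite -leeBlDr // -EFinB.
  case E : (f (y - s *: d)) (Gamma_gtNy (y - s *: d) fG) => [v||] // _; last exact: leey.
  have := x'P (y - s *: d) v; rewrite E => /(_ (lexx _)).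
  have -> : x' (y - s *: d - x0) = x' (y - x0) - s * x' d.
    by rewrite addrAC linearB linearZ.
  rewrite lee_fin /M.
  have : s * x' d <= `|x' d|.
    by rewrite (le_trans (ler_norm _)) // normrM ger0_norm // ler_piMl.
  have : - (s * c) <= `|c|.
    by rewrite (le_trans (ler_norm _)) // normrN normrM ger0_norm // ler_piMl.
  lra.
apply: contrapT => natt.
case E : (segconv f d c y) gNy => [m||] // _; last first.
  apply: natt; exists 0; split=> //.
  by have := segconv_le f d c y (lexx 0) ler01; rewrite E leye_eq => /eqP.
have [|b mb yb] := @near_segment f d c y m fl.
  move=> s s0 s1; rewrite lt_neqAle -E segconv_le // andbT.
  by apply/eqP => h; apply: natt; exists s.
suff : (b%:E <= segconv f d c y)%E by rewrite E lee_fin leNgt mb.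
by apply: le_segconv => s s0 s1; apply: ltW; exact: (nbhs_singleton yb).
Qed.

Lemma segconv_Gamma f d c : Gamma X f -> Gamma X (segconv f d c).
Proof.
move=> fG; have /GammaP[[[x0 fx0] fN] fc fl] := fG; apply/GammaP; split.
- split.
    exists x0; rewrite /edom /=.
    apply: le_lt_trans (segconv_le f d c x0 (lexx 0) ler01) _.
    by rewrite scale0r subr0 mul0r adde0.
  move=> x; have [s [_ _ ->]] := segconv_attained d c x fG.
  by have := fN (x - s *: d); case: (f _).
- move=> x1 x2 r1 r2 t.
  have [s1 [s10 s11 ->]] := segconv_attained d c x1 fG.
  have [s2 [s20 s21 ->]] := segconv_attained d c x2 fG.
  rewrite -leeBrDr // -leeBrDr // -!EFinB => h1 h2 t0 t1.
  have sle : t * s1 + (1 - t) * s2 <= 1 by nra.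
  have s0 : 0 <= t * s1 + (1 - t) * s2 by nra.
  apply: le_trans (segconv_le f d c _ s0 sle) _.
  rewrite -leeBrDr // -EFinB.
  have := fc _ _ _ _ t h1 h2 t0 t1.
  rewrite !scalerBr addrACA -opprD !scalerA -scalerDl => /le_trans; apply.
  by rewrite lee_fin; lra.
- move=> x r rg.
  have [|b rb xb] := @near_segment f d c x r fl.
    by move=> s s0 s1; apply: (lt_le_trans rg); exact: segconv_le.
  exists [set z | forall s, 0 <= s -> s <= 1 ->
    (b%:E < f (z - s *: d)%R + (s * c)%:E)%E] => // z hz.
  apply: (@lt_le_trans _ _ b%:E); first by rewrite lte_fin.
  by apply: le_segconv => s s0 s1; apply: ltW; exact: hz.
Qed.

(** The subgradient inequality is tested at z + s d with the minimizing s, and at y - s d with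
    parameter 0. The second test pays for moving the base point back by s d. *)
Lemma subdiff_segconv f d c y (y' : dual X) : Gamma X f ->
  subdiff (segconv f d c) y y' ->
  exists s u, [/\ 0 <= s, s <= 1, f (y - s *: d) = u%:E,
    segconv f d c y = (u + s * c)%:E &
    subdiff f (y - s *: d) y' /\ s * c <= s * y' d].
Proof.
move=> fG sy; have [s [s0 s1 gE]] := segconv_attained d c y fG.
have [gfin _] := sy.
have [u fu] : exists u, f (y - s *: d) = u%:E.
  by move: gfin; rewrite gE; case: (f _) => // u _; exists u.
rewrite fu -EFinD in gE.
exists s, u; split=> //; split.
  apply: (subdiffP fu) => z b fz.
  have : (segconv f d c (z + s *: d)%R <= (b + s * c)%:E)%E.
    apply: le_trans (segconv_le f d c _ s0 s1) _.
    by rewrite addrK EFinD leeD2r.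
  move=> /(subdiff_le sy gE).
  by rewrite opprB addrA; lra.
have : (segconv f d c (y - s *: d)%R <= u%:E)%E.
  apply: le_trans (segconv_le f d c _ (lexx 0) ler01) _.
  by rewrite scale0r subr0 mul0r adde0 fu.
move=> /(subdiff_le sy gE).
have -> : y' (y - s *: d - y) = - (s * y' d).
  by rewrite addrAC subrr add0r linearN linearZ.
lra.
Qed.

Lemma segconv_slope_lim f d x (M : R) : Gamma X f -> (M%:E < f x)%E ->
  exists c, (M%:E < segconv f d c x)%E.
Proof.
move=> fG Mf; have /GammaP[[[x0 fx0] _] _ fl] := fG.
have [a fa] := Gamma_fin fG fx0.
have [|x' x'P] := @affine_minorant _ _ f x0 (a - 1) fG fx0.
  by rewrite fa lte_fin; lra.
have [M' MM' M'f] := lt_ereal_dense Mf.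
have [V xV Vf] := fl _ _ M'f.
have [|[C D] [/= sC yD] CD] := @near_line _ _ x (- d) 0 V.
  by rewrite scale0r addr0.
have [e /= e0 eC] := sC.
(* [A] bounds f below on the segment. For s < e semicontinuity suffices; for s >= e the penalty s c
   lifts [A] above M'. *)
pose A := a - 1 + x' (x - x0) - `|x' d|.
pose c := Num.max 0 ((M' - A) / e).
have c0 : 0 <= c by rewrite le_max lexx.
have ce : M' - A <= e * c by rewrite mulrC -ler_pdivrMr // le_max lexx orbT.
exists c; apply: (@lt_le_trans _ _ M'%:E); first by rewrite lte_fin.
apply: le_segconv => s s0 s1.
have [se|se] := ltP s e.
  have : V (x - s *: d).
    rewrite -scalerN; apply: (CD (s, x)); split=> /=; last exact: nbhs_singleton.
    by apply: eC; rewrite /= sub0r normrN ger0_norm.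
  by move=> /Vf/ltW h; rewrite -[leLHS]adde0 leeD // lee_fin mulr_ge0.
case E : (f (x - s *: d)) (Gamma_gtNy (x - s *: d) fG) => [v||] // _; last exact: leey.
have := x'P (x - s *: d) v; rewrite E => /(_ (lexx _)).
have -> : x' (x - s *: d - x0) = x' (x - x0) - s * x' d.
  by rewrite addrAC linearB linearZ.
rewrite lee_fin.
have : s * x' d <= `|x' d|.
  by rewrite (le_trans (ler_norm _)) // normrM ger0_norm // ler_piMl.
have : e * c <= s * c by rewrite ler_wpM2r.
by move: ce; rewrite /A; lra.
Qed.

End SegmentInfConvolution.

(** * The function [smile] and the implications *)

Section Smile.
Context {R : realType} {X : tvsType R}.
Implicit Types (f : X -> \bar R) (r eps : R) (x y z a : X).

Lemma smile_le f eps x : (smile eps f x <= f x)%E.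
Proof.
apply: ge_ereal_sup => _ [[a a'] [/= [_ sa] _] <-].
by rewrite addeC; exact: sa.
Qed.

Lemma smile_gt f eps x r : (r%:E < smile eps f x)%E ->
  exists a (a' : dual X) u, [/\ subdiff f a a', f a = u%:E,
    (f a <= f x + eps%:E)%E & r < u + a' (x - a)].
Proof.
move=> /ereal_sup_gt[_ [[a a'] [/= sa fae] <-]]; have [fa _] := sa.
move=> h; exists a, a', (fine (f a)); split=> //; first by rewrite fineK.
by move: h; rewrite -(fineK fa) -EFinD lte_fin addrC.
Qed.

Lemma le_smile f eps x a (a' : dual X) u : subdiff f a a' -> f a = u%:E ->
  (f a <= f x + eps%:E)%E -> ((u + a' (x - a))%:E <= smile eps f x)%E.
Proof.
move=> sa fa fae; apply: ereal_sup_ubound; exists (a, a') => //=.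
by rewrite fa -EFinD addrC.
Qed.

Lemma dual_subC (x' : dual X) x y : x' (y - x) = - x' (x - y) :> R.
Proof. by rewrite -linearN opprB. Qed.

Lemma subdiff_monotone f : monotone_op (subdiff f).
Proof.
move=> [x x'] [y y']; rewrite /Graph /= => sx sy.
have [fx _] := sx; have [fy _] := sy.
have fxE : f x = (fine (f x))%:E by rewrite fineK.
have fyE : f y = (fine (f y))%:E by rewrite fineK.
have := subdiff_le (y := y) (b := fine (f y)) sx fxE.
have := subdiff_le (y := x) (b := fine (f x)) sy fyE.
rewrite !fineK // => /(_ (lexx _)) h1 /(_ (lexx _)).
by rewrite [x' (y - x)]dual_subC; lra.
Qed.

Lemma tilt_Gamma f (x' : dual X) : Gamma X f ->
  Gamma X (fun z => f z + (- x' z)%:E)%E.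
Proof.
move=> /GammaP[[[x0 fx0] fN] fc fl]; apply/GammaP; split.
- split; first by exists x0; rewrite /edom /= lte_add_pinfty ?ltry.
  by move=> x; have := fN x; case: (f x).
- move=> x y a b t; rewrite -!leeBrDr // -!EFinB => fa fb t0 t1.
  apply: (le_trans (fc _ _ _ _ _ fa fb t0 t1)); rewrite lee_fin.
  by rewrite linearD !linearZ /=; lra.
- move=> x r; rewrite -lteBlDr // -EFinB => /lt_ereal_dense[b rb bf].
  have [V xV Vf] := fl _ _ bf.
  pose e := b - (r - - x' x); have e0 : 0 < e by rewrite subr_gt0.
  have /cvgrPdist_lt/(_ e e0) xe := @dual_continuous _ _ x' x.
  exists (V `&` [set z | `|x' x - x' z| < e]); first exact: filterI.
  move=> z [/Vf bz] /=; rewrite ltr_norml => /andP[h1 h2].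
  rewrite -lteBlDr // -EFinB; apply: lt_trans bz; rewrite lte_fin.
  by move: h1 h2; rewrite /e; lra.
Qed.

Lemma subdiff_tilt f (x' : dual X) a (b' : dual X) :
  subdiff (fun z => f z + (- x' z)%:E)%E a b' ->
  exists c' : dual X, subdiff f a c' /\ forall z, c' z = b' z + x' z.
Proof.
move=> sb; have [c' c'E] := dual_comb 1 1 b' x'.
exists c'; split; last by move=> z; rewrite c'E !mul1r.
have [ffin _] := sb.
have [u fa] : exists u, f a = u%:E.
  by move: ffin; case: (f a) => // u _; exists u.
apply: (subdiffP fa) => y b fb; rewrite c'E !mul1r.
have /(subdiff_le sb) : (f y + (- x' y)%:E <= (b - x' y)%:E)%E.
  by rewrite EFinD leeD2r.
move=> /(_ (u - x' a)); rewrite fa -EFinD => /(_ erefl).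
by rewrite !linearB /=; lra.
Qed.

(** Otherwise the slope x' of an affine minorant with value r at x would be monotonically related to
    the whole graph. Maximality puts (x, x') in the graph, and then a = x is a witness. *)
Lemma maximal_monotone_subdiff_sup f x r : Gamma X f ->
  maximal_monotone (subdiff f) -> edom f x -> (r%:E < f x)%E ->
  exists a (a' : dual X) u, [/\ subdiff f a a', f a = u%:E & r <= u + a' (x - a)].
Proof.
move=> fG [_ _ fmax] fx rfx.
have [x' x'P] := affine_minorant fG fx rfx.
apply: contrapT => none.
have low a (a' : dual X) : subdiff f a a' -> x' (x - a) - a' (x - a) >= 0.
  move=> sa; have [fafin _] := sa.
  have [u fa] : exists u, f a = u%:E by exists (fine (f a)); rewrite fineK.
  have := x'P a u; rewrite fa => /(_ (lexx _)).
  rewrite dual_subC => h1.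
  rewrite leNgt; apply/negP => h2; apply: none; exists a, a', u; split=> //; lra.
pose S : X -> set (dual X) :=
  fun z => [set z' | subdiff f z z' \/ (z = x /\ z' = x')].
have : Graph S = Graph (subdiff f).
  apply: fmax; last by move=> p; left.
  move=> [y y'] [z z']; rewrite /Graph /S /= => -[sy|[-> ->]] [sz|[-> ->]].
  - exact: (@subdiff_monotone f (y, y') (z, z')).
  - by have := low _ _ sy; rewrite [x' (y - x)]dual_subC [y' (y - x)]dual_subC; lra.
  - exact: low.
  - by rewrite subrr.
move/seteqP => [/(_ (x, x'))/= + _]; rewrite /Graph /S /= => /(_ (or_intror _)).
move=> /(_ (conj erefl erefl)) sx.
have [c fxc] := Gamma_fin fG fx.
apply: none; exists x, x', c; split=> //.
by rewrite subrr linear0 addr0; move: rfx; rewrite fxc lte_fin => /ltW.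
Qed.

Lemma maximal_monotone_smile :
  (forall f, Gamma X f -> maximal_monotone (subdiff f)) ->
  forall f, Gamma X f -> forall eps, 0 < eps -> forall x, edom f x ->
  smile eps f x = f x.
Proof.
move=> mm f fG eps eps0 x fx; apply/eqP; rewrite eq_le smile_le /=.
have [c fxc] := Gamma_fin fG fx.
apply/lee_addgt0Pr => e e0; rewrite fxc -leeBlDr // -EFinB.
(* Subgradients of the composite then live where f a < f x + eps, as [smile] requires. *)
pose m := c + eps.
have cm : c < m by rewrite ltrDl.
have fxm : (f x < m%:E)%E by rewrite fxc lte_fin.
have FG := barrier_comp_Gamma fG (ltW fxm).
have Fx := barrier_compE fxc (ltW cm).
have [||a [a' [w [sa Fa h]]]] := maximal_monotone_subdiff_sup (x := x)
  (r := barrier m c - e) FG (mm _ FG).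
- by rewrite /edom /= Fx ltey.
- by rewrite Fx lte_fin ltrBlDr ltrDl.
have [u [b' [fa um sb a'E]]] := subdiff_barrier_comp fG fxm sa.
move: Fa; rewrite (barrier_compE fa (ltW um)) => -[uE].
have : ((u + b' (x - a))%:E <= smile eps f x)%E.
  by apply: (le_smile sb fa); rewrite fa fxc -EFinD lee_fin ltW.
apply: le_trans; rewrite lee_fin.
move: h; rewrite -uE a'E => h.
have := barrier_tangent um (ltW cm); have := barrier_slope_ge1 m u.
move: (barrier_slope m u) h => k h k1 ht.
(* The tangent inequality cancels the barrier values; since k >= 1, the error e is at most k e, and
   k can be divided out. *)
have : k * (c - u) - e <= k * b' (x - a) by lra.
have k0 : 0 < k by lra.
have : k * (c - u) - k * e <= k * (c - u) - e by nra.
move=> h1 /(le_trans h1); rewrite -!mulrBr ler_pM2l //; lra.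
Qed.

Lemma smile_outside_dom :
  (forall f, Gamma X f -> forall eps, 0 < eps -> forall x, edom f x ->
    f x = smile eps f x) ->
  forall f, Gamma X f -> forall eps, 0 < eps -> forall x, ~ edom f x ->
  f x = smile eps f x.
Proof.
move=> sm f fG eps eps0 x ndom.
have fx : f x = +oo%E.
  by apply/eqP; move/negP: ndom; rewrite /edom /= -leNgt leye_eq.
have [[[x0 fx0] _] _ _] := fG.
apply/eqP; rewrite eq_le smile_le andbT fx leye_eq; apply/eqP.
apply: eq_infty => M.
pose d := x - x0.
have [c Mc] : exists c, (M%:E < segconv f d c x)%E.
  by apply: segconv_slope_lim => //; rewrite fx ltry.
have gG := segconv_Gamma d c fG.
(* Parameter 1 moves x to x0, where f is finite. *)
have gx : edom (segconv f d c) x.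
  apply: le_lt_trans (segconv_le f _ c x ler01 (lexx 1)) _.
  by rewrite scale1r subKr lte_add_pinfty ?ltry.
have := Mc; rewrite (sm _ gG 1 ltr01 x gx).
move=> /smile_gt[b [b' [v [sb gb _ Mv]]]].
have [s [u [s0 s1 fu gu [sf sc]]]] := subdiff_segconv fG sb.
apply: le_trans (le_smile (x := x) (eps := eps) sf fu _); last by rewrite fu fx leey.
rewrite lee_fin.
move: gb; rewrite gu => -[vE].
have -> : b' (x - (b - s *: d)) = b' (x - b) + s * b' d.
  by rewrite opprB addrA addrAC linearD linearZ.
by move: Mv sc; rewrite -vE; lra.
Qed.

Lemma smile_maximal_monotone :
  (forall f, Gamma X f -> forall eps, 0 < eps -> f = smile eps f) ->
  forall f, Gamma X f -> maximal_monotone (subdiff f).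
Proof.
move=> sm f fG; split.
- have [[[x0 fx0] _] _ _] := fG; have [c fc] := Gamma_fin fG fx0.
  have : ((c - 1)%:E < smile 1 f x0)%E.
    by rewrite -(sm _ fG) // fc lte_fin; lra.
  by move=> /smile_gt[a [a' [u [sa _ _ _]]]]; exists (a, a').
- exact: subdiff_monotone.
move=> S mS fS; apply/seteqP; split=> // -[x x'] Sx; rewrite /Graph /=.
pose g z := (f z + (- x' z)%:E)%E.
have gG : Gamma X g by exact: tilt_Gamma.
(* Membership of x' in the subdifferential of f at x amounts to x being a minimizer of g with g x
   finite. *)
have gmin y : (g x <= g y)%E.
  rewrite leNgt; apply/negP => gyx.
  have gy : edom g y by rewrite /edom /= (lt_le_trans gyx) // leey.
  have [v gv] := Gamma_fin gG gy.
  have [m vm mx] : exists2 m, v < m & (m%:E < g x)%E.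
    by apply: lt_ereal_dense; rewrite -gv.
  have gym : (g y < m%:E)%E by rewrite gv lte_fin.
  have FG := barrier_comp_Gamma gG (ltW gym).
  have : (m%:E < smile 1 (barrier_comp m g) x)%E.
    by rewrite -(sm _ FG) // barrier_compy // ltry.
  move=> /smile_gt[a [a' [u [sa Fa _ mu]]]].
  have [w [b' [ga wm sb a'E]]] := subdiff_barrier_comp gG gym sa.
  move: Fa; rewrite (barrier_compE ga (ltW wm)) => -[uE].
  have [c' [sc c'E]] := subdiff_tilt sb.
  (* Monotonicity gives b' (x - a) <= 0, whereas [barrier m w] <= w < m < u + k b' (x - a) with u =
     [barrier m w] gives the opposite sign. *)
  have := mS (x, x') (a, c') Sx (fS (a, c') sc); rewrite /= c'E.
  have := barrier_slope_ge1 m w; have := barrier_le m w.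
  move: mu; rewrite a'E uE; move: (barrier_slope m w) => k.
  nra.
have [x0 gx0] : exists x0, edom g x0 by case: gG => -[].
have gx : edom g x by exact: le_lt_trans (gmin x0) gx0.
have fx : edom f x.
  move: gx; rewrite /edom /= /g; apply: contraTT.
  by rewrite -!leNgt !leye_eq => /eqP ->.
have [c fc] := Gamma_fin fG fx.
apply: (subdiffP fc) => y b fb.
have : (g y <= (b - x' y)%:E)%E by rewrite EFinD leeD2r.
move=> /(le_trans (gmin y)); rewrite /g fc -EFinD lee_fin linearB /=; lra.
Qed.

End Smile.

Theorem theorem18 (R : realType) (X : tvsType R)
    (hausdorffX : hausdorff_space X) (nontrivialX : exists x : X, x != 0) :
  [<-> forall f : X -> \bar R, Gamma X f -> maximal_monotone (subdiff f);
       forall f : X -> \bar R, Gamma X f -> forall x : X, edom f x ->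
         f x = ereal_inf [set smile eps f x | eps in [set eps : R | 0 < eps]];
       forall f : X -> \bar R, Gamma X f -> forall eps : R, 0 < eps ->
         forall x : X, edom f x -> f x = smile eps f x;
       forall f : X -> \bar R, Gamma X f -> forall eps : R, 0 < eps ->
         f = smile eps f].
Proof.
tfae.
- move=> mm f fG x fx; apply/eqP; rewrite eq_le; apply/andP; split.
    apply: le_ereal_inf_tmp => _ [eps eps0 <-].
    by rewrite maximal_monotone_smile.
  apply: le_trans (smile_le f 1 x); apply: ereal_inf_lbound; exists 1 => //=.
(* Each [smile eps f x] lies between the infimum, equal to f x, and f x. *)
- move=> inf f fG eps eps0 x fx; apply/eqP; rewrite eq_le smile_le andbT.
  by rewrite [leLHS]inf //; apply: ereal_inf_lbound; exists eps.
- move=> sm f fG eps eps0; apply/funext => x.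
  have [fx|fx] := pselect (edom f x); first exact: sm.
  exact: smile_outside_dom.
- exact: smile_maximal_monotone.
Qed.
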